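(* Let $\mathcal Y=[0,1]$ and $\delta\in(0,1]$. With probability at least $1-\delta$, uniformly on all integers $T\ge 1$ and all $y_0\in\mathcal Y$ (i.e. simultaneously for all such $T$ and $y_0$), we have $$F(y_0)\in\left[\sup_{y_-\in[0,y_0]}\psi_{T,-}^{-1}\Big(y_-,\log\tfrac{2\sqrt T}{(y_0-y_-)\delta}\Big),\ \inf_{y_+\in[y_0,1]}\psi_{T,+}^{-1}\Big(y_+,\log\tfrac{2\sqrt T}{(y_+-y_0)\delta}\Big)\right].$$
   Context: Let $(X_t)_{t\ge1}$ be i.i.d. random variables with Borel probability law $P$ on $\mathcal X\subset\mathbb R^d$. Let $f:\mathcal X\times\mathcal Y\to[0,1]$ be a Borel function such that for each $x\in\mathcal X$ the map $y\mapsto f(x,y)$ is non-decreasing. Define $F:\mathcal Y\to[0,1]$ by $F(y)=\mathbb E_P[f(X,y)]$. For $\mu\in[0,1]$ let $\mathcal A_\mu=[-\tfrac1{1-\mu},\tfrac1\mu]$, with the convention $1/0=+\infty$ (so $\alpha\in\mathcal A_\mu$ may be infinite). For $T\ge1$, $y\in\mathcal Y$, $\mu\in[0,1]$ define $$\psi_T(y,\mu)=\sup_{\alpha\in\mathcal A_\mu}\sum_{t=1}^T\log\big(1+\alpha(f(X_t,y)-\mu)\big),$$ with the conventions $0\times\infty=0$, $\log 0=-\infty$ and $\log 0+\log(+\infty)=-\infty$. For $C\in[0,+\infty]$ define $$\psi_{T,+}^{-1}(y,C)=\sup\{\mu\in[0,1]:\psi_T(y,\mu)\le C\},\qquad \psi_{T,-}^{-1}(y,C)=\inf\{\mu\in[0,1]:\psi_T(y,\mu)\le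 C\}.$$ When $y_\pm=y_0$ the second argument $\log\frac{2\sqrt T}{0}$ is $+\infty$. $\log$ is the natural logarithm. *)

(* Defs.v *)
From HB Require Import structures.
From mathcomp Require Export all_boot all_order all_algebra finmap.
From mathcomp Require Export all_classical all_reals all_analysis.

Set Implicit Arguments.
Unset Strict Implicit.
Unset Printing Implicit Defensive.

Import Order.TTheory GRing.Theory Num.Theory.
Import numFieldNormedType.Exports.

Local Open Scope classical_set_scope.
Local Open Scope ring_scope.

(* The subset [A] as a type, with the subspace topology.  A [measurableType]
   has to be pointed, hence the nonemptiness proof in the type; it costs no
   generality, since an empty set carries no probability measure. *)
Definition subset_type (T : Type) (A : set T) of A !=set0 : Type := set_type A.

Section subset_type_structures.
Variables (T : topologicalType) (A : set T) (A0 : A !=set0).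

HB.instance Definition _ := Topological.copy (subset_type A0) (set_type A).

Lemma subset_type_inhabited : exists _ : subset_type A0, True.
Proof. by case: A0 => x Ax; exists (SigSub (mem_set Ax)). Qed.

HB.instance Definition _ :=
  isPointed.Build (subset_type A0) (projT1 (cid subset_type_inhabited)).

End subset_type_structures.

(* The subset [A], measurable for its Borel sigma-algebra. *)
Notation borel_type A0 := (g_sigma_algebraType (@open (subset_type A0))).

Section iid.
Local Open Scope ereal_scope.
Context (dO d' : measure_display) (Omega : measurableType dO)
  (T : measurableType d') (R : realType) (Pr : probability Omega R).

Definition independent_RVs (I : choiceType) (X : I -> {RV Pr >-> T}) : Prop :=
  forall (J : {fset I}) (B : I -> set T),
    (forall j, j \in J -> measurable (B j)) ->
    Pr (\bigcap_(j in [set` J]) (X j @^-1` B j)) =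
      \big[*%E/1]_(j <- J) Pr (X j @^-1` B j).

Definition iid_with_law (P : probability T R) (I : choiceType)
    (X : I -> {RV Pr >-> T}) : Prop :=
  independent_RVs X /\
  forall i (B : set T), measurable B -> distribution Pr (X i) B = P B.

End iid.

Section psi.
Local Open Scope ereal_scope.
Context (R : realType) (S : Type) (f : S -> R -> R) (x : nat -> S).

(* Below, the extended-real operations satisfy [0^-1 = +oo], [0 * +oo = 0],
   [-oo + +oo = -oo] and [lne 0 = -oo]. *)

Definition bets (mu : R) : set (\bar R) :=
  [set alpha | - ((1 - mu)%:E^-1) <= alpha /\ alpha <= mu%:E^-1].

(* The sample is indexed from 0: [x t] is the observation number [t + 1]. *)
Definition psi (T : nat) (y mu : R) : \bar R :=
  ereal_sup [set \sum_(t < T) lne (1 + alpha * (f (x t) y - mu)%:E)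
            | alpha in bets mu].

Definition psi_sublevel (T : nat) (y : R) (C : \bar R) : set (\bar R) :=
  [set mu%:E | mu in [set mu : R | (0 <= mu <= 1)%R /\ psi T y mu <= C]].

Definition psi_inv_plus (T : nat) (y : R) (C : \bar R) : \bar R :=
  ereal_sup (psi_sublevel T y C).

Definition psi_inv_minus (T : nat) (y : R) (C : \bar R) : \bar R :=
  ereal_inf (psi_sublevel T y C).

(* [log (2 * sqrt T / (gap * delta))], equal to [+oo] when [gap = 0]. *)
Definition threshold (T : nat) (gap delta : R) : \bar R :=
  lne ((2 * Num.sqrt T%:R)%:E / (gap * delta)%:E).

End psi.
Arguments threshold {R}.

(* Main.v *)
(** For fixed [y], bet on the outcomes [f (X_t) y] with the odds that are fair when
    their mean is [F y], and mix all the constant bets with the Beta(1/2, 1/2)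
    (Krichevsky-Trofimov) weights.  The resulting wealth is a nonnegative martingale
    of mean 1, and it is within a factor [2 sqrt T] of the wealth of the best constant
    bet, that is, of [exp (psi_T (y, F y))].  The integral over [y] in [0, 1] of these
    wealths is still a nonnegative martingale of mean 1, so by Ville's inequality it
    stays below [1 / delta] forever with probability at least [1 - delta].  On this
    event every interval [[s, t]] contains a point [y] with wealth at most
    [1 / ((t - s) delta)], that is,
    [psi_T (y, F y) <= log (2 sqrt T / ((t - s) delta))].  Monotonicity of [f] in [y]
    carries this bound from [y] to the endpoints of the interval. *)
From HB Require Import structures.
Require Import Defs.
From mathcomp Require Import all_boot all_order all_algebra.
From mathcomp Require Import all_classical all_reals all_analysis.
From mathcomp Require Import measurable_realfun ring lra.

Import Order.TTheory GRing.Theory Num.Theory.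
Import numFieldNormedType.Exports.

Local Open Scope classical_set_scope.
Local Open Scope ring_scope.

(** * Krichevsky-Trofimov weights *)

Section log_inequalities.
Context {R : realType}.
Implicit Types (f df : R -> R) (x z : R).

Lemma is_derive_ge0_le0 f df z : 0 <= z ->
  (forall x, 0 <= x <= z -> is_derive x 1 f (df x)) ->
  (forall x, 0 <= x <= z -> 0 <= df x) -> f 0 <= f z.
Proof.
move=> z0 fdf df0; rewrite -subr_ge0.
have [||c /[!in_itv] cz ->] := @MVT_segment _ f df 0 z z0.
- by move=> x /[!in_itv]/= /andP[/ltW x0 /ltW xz]; apply: fdf; rewrite x0.
- apply: derivable_within_continuous => x /[!in_itv]/= xz.
  by have [] := fdf x xz.
- by rewrite mulr_ge0 ?df0// subr0.
Qed.

Lemma is_derive_ln_comp f x b : 0 < f x -> is_derive x 1 f b ->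
  is_derive x 1 (fun y => ln (f y)) (b / f x).
Proof.
move=> fx0 fb; have lnf := is_derive1_ln fx0.
by rewrite mulrC; exact: (@is_derive1_comp R (@ln R) f).
Qed.

Let is_derive_ln1D x : 0 < 1 + x ->
  is_derive x 1 (fun y : R => ln (1 + y)) (1 + x)^-1.
Proof.
move=> x0; apply: is_derive_eq; first exact: is_derive_ln_comp.
by rewrite add0r mul1r.
Qed.

Let is_derive_ln1B x : 0 < 1 - x ->
  is_derive x 1 (fun y : R => ln (1 - y)) (- (1 - x)^-1).
Proof.
move=> x0; apply: is_derive_eq; first exact: is_derive_ln_comp.
by rewrite add0r mul1r mulN1r.
Qed.

(** The difference of the sides vanishes at 0 and has derivative [2 x^2 / (1 - x^2)]. At
    [z = 1 / (2m + 1)], where [(1 + z) / (1 - z) = (m + 1) / m], this reads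
    [1 <= (m + 1/2) ln ((m + 1) / m)]. *)
Lemma ln_symm_ge z : 0 <= z -> z < 1 -> 2 * z <= ln (1 + z) - ln (1 - z).
Proof.
move=> z0 z1; rewrite -subr_ge0.
pose f x : R := ln (1 + x) - ln (1 - x) - 2 * x.
pose df x : R := (1 + x)^-1 + (1 - x)^-1 - 2.
suff : f 0 <= f z by rewrite /f addr0 subr0 subrr mulr0 subrr.
apply: (@is_derive_ge0_le0 f df) => // x /andP[x0 xz].
  have p1 : 0 < 1 + x by lra.
  have m1 : 0 < 1 - x by lra.
  have d1 := is_derive_ln1D _ p1; have d2 := is_derive_ln1B _ m1.
  apply: is_derive_eq; rewrite /df opprK; congr (_ - _).
  exact: mulr1.
have -> : df x = 2 * x ^+ 2 / ((1 + x) * (1 - x)) by rewrite /df; field; lra.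
by rewrite divr_ge0// ?mulr_ge0 ?sqr_ge0//; lra.
Qed.

(** The difference of the sides vanishes at 0 and has derivative [- ln (1 - x^2)], which is
    nonnegative. *)
Lemma xlnx_symm_le z : 0 <= z -> z < 1 ->
  (1 + z) * ln (1 + z) - (1 - z) * ln (1 - z) <= 2 * z.
Proof.
move=> z0 z1; rewrite -subr_ge0.
pose f x : R := 2 * x - ((1 + x) * ln (1 + x) - (1 - x) * ln (1 - x)).
pose df x : R := - ln ((1 + x) * (1 - x)).
suff : f 0 <= f z by rewrite /f addr0 subr0 mulr0 ln1 mulr0 subrr subrr.
apply: (@is_derive_ge0_le0 f df) => // x /andP[x0 xz].
  have p1 : 0 < 1 + x by lra.
  have m1 : 0 < 1 - x by lra.
  have d1 := is_derive_ln1D _ p1; have d2 := is_derive_ln1B _ m1.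
  apply: is_derive_eq; rewrite /df lnM ?posrE// /GRing.scale/=.
  by field; lra.
by rewrite /df oppr_ge0 ln_le0//; nra.
Qed.

End log_inequalities.

(** * Moments of the Beta(1/2, 1/2) law and their lower bound *)

Section kt.
Context {R : realType}.
Implicit Types (k l n : nat) (p q : R).

(* The moment E[p^k (1-p)^l] of the Beta(1/2, 1/2) law. *)
Definition kt k l : R :=
  (\prod_(i < k) (i%:R + 2^-1)) * (\prod_(i < l) (i%:R + 2^-1)) / (k + l)`!%:R.

Lemma kt00 : kt 0 0 = 1.
Proof. by rewrite /kt !big_ord0 fact0 mulr1 divr1. Qed.

Lemma ktC k l : kt k l = kt l k.
Proof. by rewrite /kt addnC [X in X / _]mulrC. Qed.

Lemma kt_recl k l : kt k.+1 l = kt k l * (k%:R + 2^-1) / (k + l).+1%:R.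
Proof.
rewrite /kt addSn factS big_ord_recr/= natrM.
field; rewrite !pnatr_eq0 -lt0n fact_gt0/=.
by rewrite andbT -natrD nat1r pnatr_eq0.
Qed.

Lemma kt_ge0 k l : 0 <= kt k l.
Proof.
by rewrite divr_ge0// mulr_ge0//; apply: prodr_ge0 => i _; rewrite addr_ge0.
Qed.

(** This is [p + (1 - p) = 1] under the expectation. The martingale property of the mixture wealth
    rests on it. *)
Lemma ktD k l : kt k.+1 l + kt k l.+1 = kt k l.
Proof.
rewrite [in X in _ + X]ktC !kt_recl [in X in _ + X]ktC (addnC l k).
have : (k + l).+1%:R != 0 :> R by [].
by rewrite -natr1 natrD => kl0; field.
Qed.

(* [(k+1)^(k+1) / (k^k (k+1/2))] increases to [e], whereas
   [((n+1)/n)^n sqrt((n+1)/n)] decreases to [e]: together they bound the ratio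
   [kt k.+1 l / kt k l] from below in the induction [kt_lb_rec]. *)
Lemma exprS_le_expR1 k :
  k.+1%:R ^+ k.+1 <= expR 1 * k%:R ^+ k * (k%:R + 2^-1) :> R.
Proof.
(* For [k = 0] the claim is [1 <= e / 2], which follows from [1 + 1 <= e]. *)
case: k => [|k]; first by have := expR_ge1Dx (1 : R); rewrite !expr1 expr0; lra.
set m : R := k.+1%:R; have m0 : 0 < m by [].
(* Chosen so that [m + 1] and [m] are [m + 1/2] times [1 + z] and [1 - z]. *)
pose z := (2 * m + 1)^-1.
have z0 : 0 < z by rewrite invr_gt0; lra.
have z1 : z < 1 by rewrite invf_lt1; lra.
have mE : (m + 2^-1) * (1 + z) = k.+2%:R.
  by rewrite -natr1 -/m /z; field; lra.
have mE' : (m + 2^-1) * (1 - z) = m by rewrite /z; field; lra.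
have := xlnx_symm_le _ (ltW z0) z1.
rewrite -(@ler_pM2l _ (m + 2^-1)); last by lra.
rewrite mulrBr !mulrA mE mE'.
have -> : (m + 2^-1) * 2 * z = 1 by rewrite /z; field; lra.
have p1 : 0 < 1 + z by lra.
have m1 : 0 < 1 - z by lra.
rewrite !mulr_natl -!lnXn// -ln_div ?posrE ?exprn_gt0//.
rewrite -[_ <= 1]ler_expR => le_e.
rewrite lnK ?posrE ?divr_gt0 ?exprn_gt0// in le_e.
rewrite ler_pdivrMr ?exprn_gt0// in le_e.
have m20 : 0 < m + 2^-1 by lra.
have -> : k.+2%:R ^+ k.+2 = (m + 2^-1) * (m + 2^-1) ^+ k.+1 * (1 + z) ^+ k.+2.
  by rewrite -exprS -exprMn mE.
have -> : m ^+ k.+1 = (m + 2^-1) ^+ k.+1 * (1 - z) ^+ k.+1.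
  by rewrite -exprMn mE'.
have h0 : 0 <= (m + 2^-1) * (m + 2^-1) ^+ k.+1 by rewrite -exprS exprn_ge0// ltW.
apply: le_trans (ler_wpM2l h0 le_e) _.
by rewrite le_eqVlt; apply/orP; left; apply/eqP; ring.
Qed.

Lemma expR1_le_exprS n : (0 < n)%N ->
  expR 1 * n%:R ^+ n * Num.sqrt n%:R <=
    n.+1%:R ^+ n * Num.sqrt n.+1%:R :> R.
Proof.
case: n => // k _; set m : R := k.+1%:R; have m0 : 0 < m by [].
pose z := (2 * m + 1)^-1.
have z0 : 0 < z by rewrite invr_gt0; lra.
have z1 : z < 1 by rewrite invf_lt1; lra.
have mE : (m + 2^-1) * (1 + z) = k.+2%:R.
  by rewrite -natr1 -/m /z; field; lra.
have mE' : (m + 2^-1) * (1 - z) = m by rewrite /z; field; lra.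
have p1 : 0 < 1 + z by lra.
have m1 : 0 < 1 - z by lra.
have r0 : 0 < (1 + z) / (1 - z) by rewrite divr_gt0.
have rE : (1 + z) / (1 - z) * m = k.+2%:R.
  by rewrite -[in X in _ * X = _]mE' -mE; field; lra.
have := ln_symm_ge _ (ltW z0) z1.
rewrite -ln_div// -(@ler_pM2l _ (m + 2^-1)); last by lra.
have -> : (m + 2^-1) * (2 * z) = 1 by rewrite /z; field; lra.
(* With square roots as exponentials of half logarithms, the factor [m + 1/2] of the logarithm
   splits into an integer power and a square root. *)
have sqE (x : R) : 0 < x -> Num.sqrt x = expR (2^-1 * ln x).
  by move=> x0; rewrite -powR12_sqrt ?ltW// /powR gt_eqF.
rewrite !sqE// -rE [ln (_ * m)]lnM ?posrE// [2^-1 * (_ + _)]mulrDr expRD => e_le.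
set r := (1 + z) / _ in r0 e_le *.
have {e_le} : expR 1 <= r ^+ k.+1 * expR (2^-1 * ln r).
  by rewrite -[in r ^+ _](lnK r0) -expRM_natl -expRD -mulrDl ler_expR.
move=> e_le; rewrite exprMn.
have h0 : 0 <= m ^+ k.+1 * expR (2^-1 * ln m) by rewrite mulr_ge0 ?expR_ge0 ?exprn_ge0 ?ltW.
rewrite -mulrA; apply: le_trans (ler_wpM2r h0 e_le) _.
by rewrite le_eqVlt; apply/orP; left; apply/eqP; ring.
Qed.

(** From [k] to [k + 1] the left side grows by a factor at most [e (k + 1/2)], the right side by a
    factor at least [e (k + 1/2)]. *)
Lemma kt_lb_rec k l : (0 < k + l)%N ->
  k%:R ^+ k * l%:R ^+ l <=
    2 * Num.sqrt (k + l)%:R * (k + l)%:R ^+ (k + l) * kt k l ->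
  k.+1%:R ^+ k.+1 * l%:R ^+ l <=
    2 * Num.sqrt (k.+1 + l)%:R * (k.+1 + l)%:R ^+ (k.+1 + l) * kt k.+1 l.
Proof.
move=> kl0 IH; rewrite addSn kt_recl.
set n := (k + l)%N in kl0 IH *; set K := kt k l in IH *.
have K0 : 0 <= K by exact: kt_ge0.
have k20 : 0 < k%:R + 2^-1 :> R by rewrite ltr_wpDl.
have -> : 2 * Num.sqrt n.+1%:R * n.+1%:R ^+ n.+1 * (K * (k%:R + 2^-1) / n.+1%:R) =
    (n.+1%:R ^+ n * Num.sqrt n.+1%:R) * (2 * K * (k%:R + 2^-1)).
  by rewrite exprS; field; rewrite nat1r pnatr_eq0.
apply: le_trans (ler_wpM2r _ (expR1_le_exprS _ kl0)); last first.
  by apply: mulr_ge0; [exact: mulr_ge0|exact: ltW].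
apply: le_trans (ler_wpM2r _ (exprS_le_expR1 k)) _; first by rewrite exprn_ge0.
have e0 : 0 <= expR 1 * (k%:R + 2^-1) :> R by rewrite mulr_ge0 ?expR_ge0 ?ltW.
have {}IH := ler_wpM2l e0 IH.
apply: le_trans (le_trans IH _); rewrite le_eqVlt; apply/orP; left.
  by apply/eqP; ring.
by apply/eqP; ring.
Qed.

Lemma kt_lb k l : (0 < k + l)%N ->
  k%:R ^+ k * l%:R ^+ l <=
    2 * Num.sqrt (k + l)%:R * (k + l)%:R ^+ (k + l) * kt k l.
Proof.
pose lb k l := k%:R ^+ k * l%:R ^+ l <=
  2 * Num.sqrt (k + l)%:R * (k + l)%:R ^+ (k + l) * kt k l.
have lbC i j : lb i j -> lb j i by rewrite /lb ktC addnC mulrC.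
(* At [(0, 0)] the right side is 0 because of the square root, so the induction starts at [(1, 0)],
   where equality holds and fixes the constant 2. *)
have lb10 : lb 1 0.
  rewrite /lb addn0 sqrtr1 !expr1 expr0 !mulr1.
  by rewrite /kt big_ord0 big_ord_recl big_ord0 add0r !mulr1 divr1 divff.
rewrite -/(lb k l); elim: k => [|k IHk].
  elim: l => [//|[_ _|l IHl _]]; first exact: lbC.
  by apply/lbC/kt_lb_rec; [rewrite addn0|apply/lbC/IHl].
case: (posnP (k + l)) => [/eqP|kl0 _]; last by apply: kt_lb_rec => //; exact: IHk.
by rewrite addn_eq0 => /andP[/eqP -> /eqP ->].
Qed.

(** This is [x / k <= exp (x / k - 1)] raised to the power [k]. *)
Lemma exprn_le_expR (x : R) k : 0 <= x -> x ^+ k <= k%:R ^+ k * expR (x - k%:R).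
Proof.
move=> x0; case: k => [|k].
  by rewrite !expr0 mul1r subr0 (le_trans _ (expR_ge1Dx x))// lerDl.
set m : R := k.+1%:R; have m0 : 0 < m by [].
have -> : x - m = m * (x / m - 1) by field; rewrite gt_eqF.
rewrite expRM_natl -exprMn lerXn2r ?nnegrE//; first by rewrite mulr_ge0 ?expR_ge0 ?ltW.
rewrite mulrC -ler_pdivrMr//; apply: le_trans (expR_ge1Dx _).
by rewrite addrC subrK.
Qed.

(** Under [p + q = 1] the product [p^k q^l] is largest at [p = k / n], [q = l / n] with [n = k + l],
    where [kt_lb] bounds it. The maximality comes from [exprn_le_expR] at [p n] and [q n]: the two
    exponents cancel. *)
Lemma exprM_le_kt p q k l : 0 <= p -> 0 <= q -> p + q = 1 -> (0 < k + l)%N ->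
  p ^+ k * q ^+ l <= 2 * Num.sqrt (k + l)%:R * kt k l.
Proof.
move=> p0 q0 pq1 kl0; have := kt_lb _ _ kl0; set n : R := (k + l)%:R => lb.
have n0 : 0 < n by rewrite ltr0n.
rewrite -(@ler_pM2r _ (n ^+ (k + l))) ?exprn_gt0// [X in _ <= X]mulrAC.
apply: le_trans lb.
have -> : p ^+ k * q ^+ l * n ^+ (k + l) = (p * n) ^+ k * (q * n) ^+ l.
  by rewrite exprD !exprMn; ring.
have -> : k%:R ^+ k * l%:R ^+ l = k%:R ^+ k * expR (p * n - k%:R) *
    (l%:R ^+ l * expR (q * n - l%:R)) :> R.
  rewrite mulrACA -expRD.
  have -> : p * n - k%:R + (q * n - l%:R) = (p + q) * n - n.
    by rewrite [in X in _ = _ - X]/n natrD; ring.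
  by rewrite pq1 mul1r subrr expR0 mulr1.
have pn0 : 0 <= p * n by rewrite mulr_ge0// ltW.
have qn0 : 0 <= q * n by rewrite mulr_ge0// ltW.
by apply: ler_pM; rewrite ?exprn_ge0// exprn_le_expR.
Qed.

End kt.

(** * Wealth of a mixture of constant bets *)

Section mixture.
Context {R : realType}.
Implicit Types (g h : nat -> nat -> R) (a b : nat -> R) (n : nat).

(* The sum over the subsets [A] of [{0, ..., n-1}] of
   [g #|A| (n - #|A|) * \prod_(i in A) a i * \prod_(i notin A) b i]. *)
Fixpoint mixture g a b n : R :=
  if n is m.+1 then
    a m * mixture (fun k l => g k.+1 l) a b m +
    b m * mixture (fun k l => g k l.+1) a b m
  else g 0 0.

Lemma mixture_ge0 g a b n : (forall k l, 0 <= g k l) ->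
  (forall i, 0 <= a i) -> (forall i, 0 <= b i) -> 0 <= mixture g a b n.
Proof.
move=> g0 a0 b0; elim: n g g0 => [|n IH] g g0 /=; first exact: g0.
by rewrite addr_ge0// mulr_ge0// IH.
Qed.

Lemma mixtureD g h a b n :
  mixture g a b n + mixture h a b n = mixture (fun k l => g k l + h k l) a b n.
Proof. by elim: n g h => [//|n IH] g h /=; rewrite -!IH; ring. Qed.

Lemma eq_mixture g g' a a' b b' n : (forall k l, g k l = g' k l) ->
  (forall i, (i < n)%N -> a i = a' i) -> (forall i, (i < n)%N -> b i = b' i) ->
  mixture g a b n = mixture g' a' b' n.
Proof.
elim: n g g' => [|n IH] g g' gg' aa' bb' /=; first exact: gg'.
by rewrite aa'// bb'//; congr (_ * _ + _ * _); apply: IH => // i ni;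
  rewrite ?aa' ?bb'// ltnW.
Qed.

(** Expand the product over the subsets and compare term by term. The factor [r] absorbs the powers
    of [p] and [q] already extracted by the induction. *)
Lemma prod_le_mixture g a b n p q r :
  (forall i, 0 <= a i) -> (forall i, 0 <= b i) ->
  (forall k l, (k + l)%N = n -> r * (p ^+ k * q ^+ l) <= g k l) ->
  r * \prod_(i < n) (a i * p + b i * q) <= mixture g a b n.
Proof.
move=> a0 b0; elim: n g r => [|n IH] g r rg /=.
  by rewrite big_ord0; have := rg 0%N 0%N erefl; rewrite !expr0 mulr1.
rewrite big_ord_recr/=.
set Pi := \prod_(i < n) _ in IH *.
have -> : r * (Pi * (a n * p + b n * q)) =
    a n * (r * p * Pi) + b n * (r * q * Pi) by ring.
apply: lerD; apply: ler_wpM2l => //; apply: IH => k l kl.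
  by rewrite -mulrA (mulrA p) -exprS rg// addSn kl.
by rewrite -mulrA (mulrCA q) -exprS rg// addnS kl.
Qed.

(** Each term of the expanded product obeys [exprM_le_kt]. The left side is the wealth of the
    constant bet that splits the capital as [(p, q)], so [2 sqrt n] bounds the regret of the
    mixture. *)
Lemma kt_wealth_ge a b n p q : (0 < n)%N ->
  (forall i, 0 <= a i) -> (forall i, 0 <= b i) ->
  0 <= p -> 0 <= q -> p + q = 1 ->
  \prod_(i < n) (a i * p + b i * q) <= 2 * Num.sqrt n%:R * mixture kt a b n.
Proof.
move=> n0 a0 b0 p0 q0 pq1.
have c0 : 0 < 2 * Num.sqrt n%:R :> R by rewrite mulr_gt0// sqrtr_gt0 ltr0n.
rewrite -ler_pdivrMl//; apply: prod_le_mixture => // k l kl.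
by rewrite ler_pdivrMl// -{1}kl exprM_le_kt// kl.
Qed.

Lemma ktD_mixture a b n :
  mixture (fun k l => kt k.+1 l) a b n + mixture (fun k l => kt k l.+1) a b n =
  mixture kt a b n.
Proof. by rewrite mixtureD; apply: eq_mixture => // k l; rewrite ktD. Qed.

End mixture.

(** * Independence and maximal inequality *)

Section independence_of_past.
Local Open Scope ereal_scope.
Context {dO d' : measure_display} {Omega : measurableType dO}
  {S : measurableType d'} {R : realType} {Pr : probability Omega R}
  {P : probability S R} {X : nat -> {RV Pr >-> S}}.

Definition cylinders n : set (set Omega) :=
  [set \bigcap_(j in `I_n) (X j @^-1` B j) |
    B in [set B : nat -> set S | forall j, measurable (B j)]].

(* A copy of [Omega] with the sigma-algebra generated by [X 0, ..., X n.-1]. *)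
Definition past n := g_sigma_algebraType (cylinders n).

Lemma measurable_cylinder n A : cylinders n A -> measurable A.
Proof.
move=> [B mB <-]; apply: bigcap_measurableType => j _.
by rewrite -[X in measurable X]setTI; exact: measurable_funP.
Qed.

Lemma setI_closed_cylinders n : setI_closed (cylinders n).
Proof.
move=> _ _ [B mB <-] [C mC <-]; exists (fun j => B j `&` C j).
  by move=> j; exact: measurableI.
by rewrite -bigcapI.
Qed.

Lemma cylindersT n : cylinders n setT.
Proof. by exists (fun=> setT) => //; apply/seteqP; split. Qed.

Lemma measurable_past n (A : set (past n)) : measurable A ->
  measurable (A : set Omega).
Proof.
move: A; apply: smallest_sub; first exact: sigma_algebra_measurable.
exact: measurable_cylinder.
Qed.

(** The identity, seen as a random variable in the coarser space; its law is the restriction of [Pr]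
    to the past. *)
Definition to_past n (w : Omega) : past n := w.

Lemma measurable_to_past n : measurable_fun setT (to_past n).
Proof. by move=> _ A mA; rewrite setTI; exact: (measurable_past n A mA). Qed.

HB.instance Definition _ n :=
  isMeasurableFun.Build _ _ _ _ _ (measurable_to_past n).

Lemma measurable_past_RV n j : (j < n)%N ->
  measurable_fun setT (X j : past n -> S).
Proof.
move=> jn _ A mA; rewrite setTI; apply: sub_sigma_algebra.
exists (fun i => if i == j then A else setT); first by move=> i; case: ifP.
apply/seteqP; split => [w /(_ _ jn)|w Ajw i _] /=; first by rewrite eqxx.
by case: ifPn => // /eqP ->.
Qed.

Hypothesis HX : iid_with_law P X.

Lemma cylinder_indep n A B : cylinders n A -> measurable B ->
  Pr (A `&` X n @^-1` B) = Pr A * P B.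
Proof.
move=> [C mC <-] mB; have [iX lawX] := HX.
(* With [B] placed at index [n], both sides become intersections over an initial segment of
   indices. *)
pose C' j := if (j < n)%N then C j else B.
have mC' j : measurable (C' j) by rewrite /C'; case: ifP.
have PrE m : Pr (\bigcap_(j in `I_m) (X j @^-1` C' j)) =
    \prod_(j <- iota 0 m) Pr (X j @^-1` C' j).
  pose J := [fset i in iota 0 m]%fset.
  have -> : `I_m = [set` J].
    by apply/seteqP; split => j /=; rewrite inE/= mem_iota.
  rewrite iX//; apply: perm_big; apply: uniq_perm => [||j].
  - exact: fset_uniq.
  - exact: iota_uniq.
  - by rewrite inE.
have -> : \bigcap_(j in `I_n) (X j @^-1` C j) =
    \bigcap_(j in `I_n) (X j @^-1` C' j).
  by apply: eq_bigcapr => j /= jn; rewrite /C' jn.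
have -> : X n @^-1` B = X n @^-1` C' n by rewrite /C' ltnn.
have -> : P B = Pr (X n @^-1` C' n) by rewrite -(lawX n)// /C' ltnn.
have -> : \bigcap_(j in `I_n) (X j @^-1` C' j) `&` X n @^-1` C' n =
    \bigcap_(j in `I_n.+1) (X j @^-1` C' j).
  by rewrite !bigcap_mkord big_ord_recr.
rewrite !PrE.
by rewrite -addn1 iotaD big_cat/= big_seq1 add0n.
Qed.

(** For fixed [B] both sides are finite measures in [A]; they agree on the cylinders, a generating
    class that is closed under intersection and contains the whole space. *)
Lemma past_indep n (A : set (past n)) B : measurable A -> measurable B ->
  Pr (A `&` X n @^-1` B) = Pr A * P B.
Proof.
move=> mA mB.
have mXB : measurable (X n @^-1` B).
  by rewrite -[X in measurable X]setTI; exact: measurable_funP.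
pose r : {nonneg R} := NngNum (fine_ge0 (measure_ge0 P B)).
have rE : r%:num%:E = P B by rewrite /= fineK// fin_num_measure.
pose m1 : {measure set Omega -> \bar R} := mrestr Pr mXB.
pose m2 : {measure set Omega -> \bar R} := mscale r Pr.
have -> : Pr A * P B = m2 A by rewrite /m2/= /mscale rE muleC.
apply: (@g_sigma_algebra_measure_unique _ _ _ (cylinders n) _ (fun=> setT) _ _ m1 m2).
- exact: measurable_cylinder.
- by move=> ?; exact: cylindersT.
- by rewrite bigcup_const.
- exact: setI_closed_cylinders.
- by move=> C cC; rewrite /m2/= /mscale rE muleC; exact: cylinder_indep.
- by move=> _; rewrite ltey_eq fin_num_measure.
- exact: mA.
Qed.

Definition joint_past n (w : Omega) : past n * S := (to_past n w, X n w).

Lemma measurable_joint_past n : measurable_fun setT (joint_past n).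
Proof. exact: measurable_fun_pair. Qed.

HB.instance Definition _ n :=
  isMeasurableFun.Build _ _ _ _ _ (measurable_joint_past n).

(** By [past_indep] the joint law of the past and [X n] is a product measure, so Tonelli applies. *)
Lemma integral_past_indep n (g : past n * S -> \bar R) :
  measurable_fun setT g -> (forall z, 0 <= g z) ->
  \int[Pr]_w g (to_past n w, X n w) = \int[Pr]_w \int[P]_x g (to_past n w, x).
Proof.
move=> mg g0.
pose Q : probability (past n) R := distribution Pr (to_past n).
have QPE (A : set (past n * S)) : measurable A ->
    (Q \x P) A = distribution Pr (joint_past n) A.
  apply: product_measure_unique => B C mB mC.
  exact: past_indep.
rewrite -[LHS]/(\int[Pr]_w (g \o joint_past n) w).
rewrite -(ge0_integral_distribution (joint_past n) mg g0).
rewrite -(eq_measure_integral _ (fun A mA _ => QPE A mA)) fubini_tonelli1//.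
rewrite (ge0_integral_distribution (to_past n))//.
- exact: measurable_fun_fubini_tonelli_F.
- by move=> w; apply: integral_ge0.
Qed.

End independence_of_past.

(** * Ville's maximal inequality *)

Section ville.
Local Open Scope ereal_scope.
Context {dO : measure_display} {Omega : measurableType dO} {R : realType}.
Implicit Type M : nat -> Omega -> \bar R.

(** Time 0 is left out: a process that starts at 1 is not strictly below [c = 1], the level used for
    [delta = 1]. *)
Definition below M (c : R) n : set Omega :=
  [set w | forall j, (0 < j <= n)%N -> M j w < c%:E].

Lemma below0 M c : below M c 0 = setT.
Proof. by apply/seteqP; split => // w _ j /andP[]; case: j. Qed.

Lemma belowS M c n : below M c n.+1 = below M c n `&` [set w | M n.+1 w < c%:E].
Proof.
apply/seteqP; split => [w Mw|w [Mw Mnw] j /andP[j0]].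
  split=> [j /andP[j0 jn]|]; last by apply: Mw; rewrite ltnSn.
  by apply: Mw; rewrite j0 leqW.
by rewrite leq_eqVlt => /predU1P[->//|jn]; apply: Mw; rewrite j0.
Qed.

Lemma measurable_below M c n :
  (forall j, (j <= n)%N -> measurable_fun setT (M j)) -> measurable (below M c n).
Proof.
elim: n => [_|n IH mM]; first by rewrite below0.
rewrite belowS; apply: measurableI.
  by apply: IH => j jn; apply: mM; rewrite leqW.
rewrite -[X in measurable X]setTI.
by apply: emeasurable_fun_infty_o => //; exact: mM.
Qed.

(** The invariant [inv] says that the process frozen at the value [c] on reaching that level keeps
    mean at most 1. The supermartingale inequality is asked only on the events where the level has
    not been reached. *)
Lemma ville (Pr : probability Omega R) M c : (0 < c)%R ->
  (forall n, measurable_fun setT (M n)) -> (forall n w, 0 <= M n w) ->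
  \int[Pr]_w M 0%N w <= 1 ->
  (forall n, \int[Pr]_(w in below M c n) M n.+1 w <=
             \int[Pr]_(w in below M c n) M n w) ->
  (1 - c^-1)%:E <= Pr (\bigcap_n below M c n).
Proof.
move=> c0 mM M_ge0 M0 superM.
have mB n : measurable (below M c n) by exact: measurable_below.
have inv n : c%:E * Pr (~` below M c n) + \int[Pr]_(w in below M c n) M n w <= 1.
  elim: n => [|n IH]; first by rewrite below0 setCT measure0 mule0 add0e.
  (* The outcomes that reach [c] for the first time at [n + 1]; there [M n.+1] is at least [c],
     which pays for the growth of the first term. *)
  pose D := below M c n `&` [set w | c%:E <= M n.+1 w].
  have mD : measurable D.
    apply: measurableI => //; rewrite -[X in measurable X]setTI.
    by apply: emeasurable_fun_c_infty => //; exact: mM.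
  have BE : below M c n = below M c n.+1 `|` D.
    by rewrite belowS /D -setIUr -[LHS]setIT; congr (_ `&` _); apply/seteqP;
      split => // w _ /=; case: (ltP (M n.+1 w) c%:E); [left|right].
  have BD0 : [disjoint below M c n.+1 & D].
    rewrite belowS; apply/disj_setPS => w [[_ /=]] + [_ /=].
    by move=> lt_c /(lt_le_trans lt_c); rewrite ltxx.
  have -> : ~` below M c n.+1 = ~` below M c n `|` D.
    rewrite belowS setCI /D setUIr setUCl setTI; congr (_ `|` _).
    by apply/seteqP; split => w /=; rewrite leNgt => /negP.
  rewrite measureU//; last first.
  - by rewrite /D setIA setICl set0I.
  - exact: measurableC.
  rewrite muleDr//; last by rewrite ge0_adde_def// inE.
  apply: le_trans IH; rewrite -addeA; apply: leeD2l.
  apply: le_trans (superM n).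
  have -> := congr1 (fun A => \int[Pr]_(w in A) M n.+1 w) BE.
  rewrite ge0_integral_setU//; last exact: measurable_funTS.
  rewrite addeC; apply: leeD2l.
  rewrite -integral_cst//; apply: ge0_le_integral => //.
  - by move=> w _; rewrite lee_fin ltW.
  - exact: measurable_funTS.
  - by move=> w [].
have PrB n : (1 - c^-1)%:E <= Pr (below M c n).
  have := inv n.
  rewrite probability_setC// => inv_n.
  have : c%:E * (1 - Pr (below M c n)) <= 1.
    by apply: le_trans inv_n; rewrite leeDl// integral_ge0.
  have : Pr (below M c n) \is a fin_num by rewrite fin_num_measure.
  case: (Pr (below M c n)) => // r _; rewrite -EFinB -EFinM !lee_fin mulrC.
  by rewrite -ler_pdivlMr// div1r; lra.
(* The bound passes to all times at once by continuity from above. *)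
have ni : nonincreasing_seq (below M c).
  move=> m n mn; rewrite subsetEset => w Mw j /andP[j0 jm].
  by apply: Mw; rewrite j0 (leq_trans jm).
have cvgB : Pr \o below M c @ \oo --> Pr (\bigcap_n below M c n).
  apply: nonincreasing_cvg_mu => //; last exact: bigcap_measurableType.
  by rewrite ltey_eq fin_num_measure.
rewrite -(cvg_lim _ cvgB)//; apply: lime_ge; first by apply/cvg_ex; eexists; exact: cvgB.
by apply: nearW => n; exact: PrB.
Qed.

End ville.

(** * The wealth averaged over the parameter is a martingale *)

Section mixture_martingale.
Local Open Scope ereal_scope.
Context {dO d' dY : measure_display} {Omega : measurableType dO}
  {S : measurableType d'} {Y : measurableType dY} {R : realType}
  {Pr : probability Omega R} {P : probability S R} {Q : probability Y R}
  {X : nat -> {RV Pr >-> S}}.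

Lemma measurable_mixture {d} {Z : measurableType d} g (A B : nat -> Z -> R) n :
  (forall i, (i < n)%N -> measurable_fun setT (A i)) ->
  (forall i, (i < n)%N -> measurable_fun setT (B i)) ->
  measurable_fun setT (fun z => mixture g (A ^~ z) (B ^~ z) n).
Proof.
elim: n g => [|n IH] g mA mB /=; first exact: measurable_cst.
by apply: measurable_funD; apply: measurable_funM; (exact: mA || exact: mB ||
  by apply: IH => i ni; (apply: mA || apply: mB); rewrite leqW).
Qed.

Variables (a b : S * Y -> R).
Hypotheses (ma : measurable_fun setT a) (mb : measurable_fun setT b).
Hypotheses (a0 : forall z, (0 <= a z)%R) (b0 : forall z, (0 <= b z)%R).
Hypothesis a1 : forall y, \int[P]_x (a (x, y))%:E = 1.
Hypothesis b1 : forall y, \int[P]_x (b (x, y))%:E = 1.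

(** Here [a] and [b] are the payoffs of unit bets on the two outcomes, fair under [P] for every
    [y]. *)
Definition wealth n (x : nat -> S) y : R :=
  mixture kt (fun i => a (x i, y)) (fun i => b (x i, y)) n.

Definition mean_wealth n (w : Omega) : \bar R :=
  \int[Q]_y (wealth n (X ^~ w) y)%:E.

Lemma wealth_ge0 n x y : (0 <= wealth n x y)%R.
Proof. by apply: mixture_ge0 => // k l; exact: kt_ge0. Qed.

Lemma mean_wealth_ge0 n w : 0 <= mean_wealth n w.
Proof. by apply: integral_ge0 => y _; rewrite lee_fin wealth_ge0. Qed.

Lemma mean_wealth0 w : mean_wealth 0 w = 1.
Proof.
rewrite /mean_wealth /wealth/= kt00 integral_cst//.
by rewrite -[X in _ * X]/(Q setT) probability_setT mule1.
Qed.

Lemma measurable_mixture_RV {d} {Z : measurableType d} g (x : nat -> Z -> S) n :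
  (forall i, (i < n)%N -> measurable_fun setT (x i)) ->
  measurable_fun setT (fun z : Z * Y =>
    mixture g (fun i => a (x i z.1, z.2)) (fun i => b (x i z.1, z.2)) n).
Proof.
move=> mx; apply: (measurable_mixture g (fun i z => a (x i z.1, z.2))
  (fun i z => b (x i z.1, z.2))) => i ni.
  apply: measurableT_comp => //; apply: measurable_fun_pair => //.
  by apply: measurableT_comp => //; exact: mx.
apply: measurableT_comp => //; apply: measurable_fun_pair => //.
by apply: measurableT_comp => //; exact: mx.
Qed.

(** The space [Z] is arbitrary so that the lemma applies both to [Omega] and to [past n], where only
    the first [n] samples are measurable. *)
Lemma measurable_mean_wealth {d} {Z : measurableType d} (x : nat -> Z -> S) n :
  (forall i, (i < n)%N -> measurable_fun setT (x i)) ->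
  measurable_fun setT (fun z => \int[Q]_y (wealth n (x ^~ z) y)%:E).
Proof.
move=> mx; pose h (z : Z * Y) := (wealth n (x ^~ z.1) z.2)%:E.
have mh : measurable_fun setT h.
  by apply/measurable_EFinP; exact: measurable_mixture_RV.
apply: (@measurable_fun_fubini_tonelli_F _ _ Z Y R Q h) => // z.
by rewrite lee_fin wealth_ge0.
Qed.

Lemma integral_affine (u v : R) y : (0 <= u)%R -> (0 <= v)%R ->
  \int[P]_x (a (x, y) * u + b (x, y) * v)%:E = (u + v)%:E.
Proof.
move=> u0 v0.
have m1 : measurable_fun setT (fun x => (a (x, y))%:E).
  by apply/measurable_EFinP; exact: measurable_fun_pair1.
have m2 : measurable_fun setT (fun x => (b (x, y))%:E).
  by apply/measurable_EFinP; exact: measurable_fun_pair1.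
under eq_integral do rewrite EFinD !EFinM.
rewrite ge0_integralD//; last 4 first.
- by move=> x _; rewrite mule_ge0// lee_fin.
- by apply: emeasurable_funM => //; exact: measurable_cst.
- by move=> x _; rewrite mule_ge0// lee_fin.
- by apply: emeasurable_funM => //; exact: measurable_cst.
rewrite !ge0_integralZr ?lee_fin// ?a1 ?b1 ?mul1e//.
- by move=> x _; rewrite lee_fin.
- by move=> x _; rewrite lee_fin.
Qed.

Local Notation pastX := (past (X := X)).

Hypothesis HX : iid_with_law P X.

(** The event depends on the first [n] samples only, so the next sample can be integrated out with
    the past fixed. This turns [a U + b V] into [U + V], which is the wealth at time [n] by
    [ktD]. *)
Lemma mean_wealth_martingale c n :
  \int[Pr]_(w in below mean_wealth c n) mean_wealth n.+1 w =
  \int[Pr]_(w in below mean_wealth c n) mean_wealth n w.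
Proof.
set B := below _ _ _.
pose B' : set (pastX n) := B.
have mXp i : (i < n)%N -> measurable_fun setT (X i : pastX n -> S).
  exact: measurable_past_RV.
have mB' : measurable B'.
  apply: (@measurable_below _ (pastX n) _ mean_wealth) => j jn.
  apply: (measurable_mean_wealth (Z := pastX n) X) => i ij.
  by apply: mXp; exact: leq_trans jn.
pose U (w : pastX n) y :=
  mixture (fun k l => kt k.+1 l) (fun i => a (X i w, y)) (fun i => b (X i w, y)) n.
pose V (w : pastX n) y :=
  mixture (fun k l => kt k l.+1) (fun i => a (X i w, y)) (fun i => b (X i w, y)) n.
have U0 w y : (0 <= U w y)%R by apply: mixture_ge0 => // k l; exact: kt_ge0.
have V0 w y : (0 <= V w y)%R by apply: mixture_ge0 => // k l; exact: kt_ge0.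
pose h (z : pastX n * S * Y) : R :=
  (a (z.1.2, z.2) * U z.1.1 z.2 + b (z.1.2, z.2) * V z.1.1 z.2)%R.
have h0 z : (0 <= h z)%R by rewrite addr_ge0// mulr_ge0.
have mX1 i : (i < n)%N ->
    measurable_fun setT (fun z : pastX n * S => X i z.1).
  by move=> ni; apply: measurableT_comp; [exact: mXp|exact: measurable_fst].
have mh : measurable_fun setT h.
  have m2 : measurable_fun setT (fun z : pastX n * S * Y => (z.1.2, z.2)).
    by apply: measurable_fun_pair => //; exact: measurableT_comp.
  apply: measurable_funD; apply: measurable_funM.
  - by apply: measurableT_comp.
  - exact: (measurable_mixture_RV _ (fun i (z : pastX n * S) => X i z.1)).
  - by apply: measurableT_comp.
  - exact: (measurable_mixture_RV _ (fun i (z : pastX n * S) => X i z.1)).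
pose g (z : pastX n * S) := \int[Q]_y (h (z, y))%:E.
(* The restriction to the event goes into the integrand, a function of the past and of the new
   sample. *)
pose gB := g \_ (B' `*` setT).
have mg : measurable_fun setT g.
  apply: (@measurable_fun_fubini_tonelli_F _ _ (pastX n * S)%type Y R Q (EFin \o h)).
    exact/measurable_EFinP.
  by move=> z; rewrite lee_fin.
have g0 z : 0 <= g z by apply: integral_ge0 => y _; rewrite lee_fin.
have mgB : measurable_fun setT gB.
  apply/(measurable_restrictT _ _).1; first exact: measurableX.
  exact: measurable_funTS.
have gB0 z : 0 <= gB z by rewrite /gB patchE; case: ifP.
transitivity (\int[Pr]_w gB (to_past n w, X n w)).
  rewrite integral_mkcond; apply: eq_integral => w _.
  rewrite /gB !patchE in_setX in_setT andbT.
  by case: ifPn.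
rewrite (integral_past_indep HX)//.
rewrite [RHS]integral_mkcond; apply: eq_integral => w _.
rewrite patchE; case: ifPn => wB; last first.
  rewrite integral0_eq// => x _; rewrite /gB patchE in_setX.
  by rewrite /B' /to_past (negbTE wB).
transitivity (\int[P]_x g (w, x)).
  apply: eq_integral => x _; rewrite /gB patchE in_setX in_setT andbT.
  by rewrite /B' /to_past wB.
rewrite /g.
(* Exchange the integrals so that the new sample is averaged first, at fixed [y]. *)
rewrite (@fubini_tonelli _ _ S Y R P Q (fun z => (h ((w, z.1), z.2))%:E))//=; last 2 first.
- apply/measurable_EFinP; apply: (measurableT_comp mh).
  by apply: measurable_fun_pair => //; exact: measurable_fun_pair.
- by move=> z; rewrite lee_fin.
apply: eq_integral => y _; rewrite (integral_affine (U w y) (V w y))//.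
by rewrite /wealth -ktD_mixture.
Qed.

Lemma mean_wealth_ville c : (0 < c)%R ->
  (1 - c^-1)%:E <= Pr (\bigcap_n below mean_wealth c n).
Proof.
move=> c0; apply: ville => //.
- move=> n; apply: (measurable_mean_wealth X) => i _; exact: measurable_funP.
- exact: mean_wealth_ge0.
- under eq_integral do rewrite mean_wealth0.
  by rewrite integral_cst// -[X in _ * X]/(Pr setT) probability_setT mule1.
- by move=> n; rewrite mean_wealth_martingale.
Qed.

End mixture_martingale.

(** * The function psi *)

Section log_wealth.
Local Open Scope ereal_scope.
Context {R : realType}.
Implicit Types (v : nat -> R) (mu r : R) (alpha : \bar R) (n : nat).

Definition log_wealth v n mu alpha : \bar R :=
  \sum_(t < n) lne (1 + alpha * (v t - mu)%:E).

Lemma bets_pinfty mu : bets mu +oo -> mu = 0%R.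
Proof. by case=> _; rewrite leye_eq inve_eqy => /eqP[]. Qed.

Lemma bets_fin mu r : (0 < mu < 1)%R ->
  bets mu r%:E <-> ((- (1 - mu)^-1 <= r)%R /\ (r <= mu^-1)%R).
Proof.
move=> /andP[mu0 mu1]; rewrite /bets/= !inver !gt_eqF ?subr_gt0//.
Qed.

(** Exchanging the outcomes 0 and 1 turns [v], [mu], [alpha] into [1 - v], [1 - mu], [- alpha]; this
    symmetry halves the case analyses below. *)
Lemma bets_flip mu alpha : bets mu alpha -> bets (1 - mu) (- alpha).
Proof.
by case=> ? ?; split; [rewrite subKr leeN2|rewrite leeNl].
Qed.

Lemma log_wealth_flip v n mu alpha :
  log_wealth (fun t => 1 - v t)%R n (1 - mu) (- alpha) = log_wealth v n mu alpha.
Proof.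
apply: eq_bigr => t _; congr (lne (1 + _)).
by rewrite mulNe -muleN -EFinN; congr (_ * _%:E)%E; ring.
Qed.

Lemma payoff_ge_above mu r alpha : (0 <= mu <= 1)%R -> (mu <= r <= 1)%R ->
  bets mu alpha -> - (1) <= alpha * (r - mu)%:E.
Proof.
move=> /andP[mu0 mu1] /andP[mur r1] [alpha_ge _].
have [a0|a0] := leP 0 alpha.
  by rewrite (@le_trans _ _ 0)// ?leeN10// mule_ge0// lee_fin subr_ge0.
(* When [r = mu] the payoff is 0 even for an infinite bet; otherwise [mu < 1] and the lower bound on
   [alpha] is finite. *)
move: mur; rewrite le_eqVlt => /predU1P[->|mur].
  by rewrite subrr mule0 leeN10.
have mu1' : (0 < 1 - mu)%R by lra.
rewrite inver gt_eqF// -EFinN in alpha_ge.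
apply: le_trans (lee_wpmul2r _ alpha_ge); last by rewrite lee_fin; lra.
rewrite -EFinM -EFinN lee_fin mulNr lerN2 mulrC ler_pdivrMr//; lra.
Qed.

Lemma payoff_ge mu r alpha : (0 <= mu <= 1)%R -> (0 <= r <= 1)%R ->
  bets mu alpha -> - (1) <= alpha * (r - mu)%:E.
Proof.
move=> mu01 r01 Ba; have [mur|rmu] := leP mu r.
  by apply: payoff_ge_above => //; case/andP: r01 => _ ->; rewrite mur.
have -> : alpha * (r - mu)%:E = - alpha * ((1 - r) - (1 - mu))%:E.
  by rewrite mulNe -muleN -EFinN; congr (_ * _%:E)%E; ring.
apply: payoff_ge_above; last exact: bets_flip; lra.
Qed.

(** For a finite bet, sum the inequality [ln (1 + x) <= x]. *)
Lemma log_wealth_le0 v n mu alpha : (0 <= mu <= 1)%R ->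
  (forall t, 0 <= v t <= 1)%R -> bets mu alpha -> 0 <= alpha ->
  (\sum_(t < n) (v t - mu) <= 0)%R -> log_wealth v n mu alpha <= 0.
Proof.
move=> mu01 v01 Ba; case: alpha Ba => [r Br|Boo _|//].
  rewrite lee_fin => r0 sum_le0.
  apply: (@le_trans _ _ (\sum_(t < n) (r * (v t - mu))%:E)).
    apply: lee_sum => t _; rewrite EFinM; apply: le_lne1Dx.
    exact: payoff_ge.
  by rewrite sumEFin lee_fin -mulr_sumr mulr_ge0_le0.
(* An infinite bet forces [mu = 0]; then the first [n] samples vanish and, as [0 * +oo = 0], every
   term is [lne 1]. *)
have /bets_pinfty -> := Boo => sum_le0.
have v0 (t : 'I_n) : v t = 0%R.
  have vt0 (i : 'I_n) : true -> (0 <= v i - 0)%R by have := v01 i; lra.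
  have /eqP : (\sum_(t < n) (v t - 0) = 0)%R.
    by apply/eqP; rewrite eq_le sum_le0 sumr_ge0.
  by rewrite psumr_eq0// => /allP/(_ t (mem_index_enum _))/=; rewrite subr0 => /eqP.
rewrite /log_wealth big1// => t _.
by rewrite v0 subrr mule0 adde0 lne1.
Qed.

Lemma log_wealth_le0_npos v n mu alpha : (0 <= mu <= 1)%R ->
  (forall t, 0 <= v t <= 1)%R -> bets mu alpha -> alpha <= 0 ->
  (0 <= \sum_(t < n) (v t - mu))%R -> log_wealth v n mu alpha <= 0.
Proof.
move=> mu01 v01 Ba a0 sum_ge0; rewrite -log_wealth_flip.
apply: log_wealth_le0; [lra|by move=> t; have := v01 t; lra|exact: bets_flip| |].
  by rewrite oppe_ge0.
rewrite -oppr_ge0 -sumrN; congr (0 <= _)%R : sum_ge0.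
by apply: eq_bigr => t _; ring.
Qed.

Lemma le_log_wealth v v' n mu alpha : (0 <= mu <= 1)%R ->
  (forall t, 0 <= v t <= 1)%R -> (forall t, 0 <= v' t <= 1)%R ->
  (forall t, v t <= v' t)%R -> bets mu alpha -> alpha <= 0 ->
  log_wealth v' n mu alpha <= log_wealth v n mu alpha.
Proof.
move=> mu01 v01 v01' vv' Ba a0; apply: lee_sum => t _.
have pos r : (0 <= r <= 1)%R -> 1 + alpha * (r - mu)%:E \in `[0, +oo].
  by move=> r01; rewrite in_itv/= leey andbT addeC -leeBlDr// sub0e payoff_ge.
rewrite lee_lne ?pos//; apply: leeD2l.
by rewrite -leeN2 -!mulNe lee_wpmul2l ?oppe_ge0// lee_fin lerB.
Qed.

(* For [v t = f (x t) y] this is [psi f x n y mu], up to conversion. *)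
Definition sup_log_wealth v n mu : \bar R :=
  ereal_sup [set log_wealth v n mu alpha | alpha in bets mu].

Lemma sup_log_wealth_cst n mu : sup_log_wealth (fun=> mu) n mu <= 0.
Proof.
apply: ge_ereal_sup => _ [alpha Ba <-]; rewrite /log_wealth big1// => t _.
by rewrite subrr mule0 adde0 lne1.
Qed.

Lemma sup_log_wealth_flip v n mu :
  sup_log_wealth (fun t => 1 - v t)%R n (1 - mu) = sup_log_wealth v n mu.
Proof.
congr ereal_sup; apply/seteqP; split => _ [alpha Ba <-].
  exists (- alpha); first by have := bets_flip _ _ Ba; rewrite subKr.
  by rewrite -log_wealth_flip oppeK.
by exists (- alpha); [exact: bets_flip|rewrite log_wealth_flip].
Qed.

(* Take for [mu'] the maximum of [mu] and of the mean of [v'].  By concavity of the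
   logarithm a bet above [mu'] has no gain; a bet below [mu'] gains less on [v'] than
   on [v] if [mu'] is [mu], and has no gain if [mu'] is the mean. *)
Lemma sup_log_wealth_up v v' n mu (C : \bar R) : (0 < n)%N -> (0 <= mu <= 1)%R ->
  (forall t, 0 <= v t <= 1)%R -> (forall t, 0 <= v' t <= 1)%R ->
  (forall t, v t <= v' t)%R -> 0 <= C -> sup_log_wealth v n mu <= C ->
  exists2 mu', (mu <= mu' <= 1)%R & sup_log_wealth v' n mu' <= C.
Proof.
move=> n0 mu01 v01 v01' vv' C0 supC.
pose m := ((\sum_(t < n) v' t) / n%:R)%R.
have n0' : (0 < n%:R :> R)%R by rewrite ltr0n.
have sumE r : (\sum_(t < n) (v' t - r) = (m - r) * n%:R)%R.
  rewrite big_split/= sumr_const card_ord mulrBl -mulrA mulVf ?gt_eqF// mulr1.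
  by rewrite -(mulr_natr (- r)) mulNr.
have m0 : (0 <= m)%R.
  by rewrite divr_ge0// sumr_ge0// => t _; case/andP: (v01' t).
have m1 : (m <= 1)%R.
  rewrite ler_pdivrMr// mul1r -[n in X in (_ <= X)%R]card_ord -sum1_card natr_sum.
  by apply: ler_sum => t _; case/andP: (v01' t).
have [mmu|mum] := leP m mu.
  exists mu; first by case/andP: mu01 => _ ->; rewrite lexx.
  apply: ge_ereal_sup => _ [alpha Ba <-].
  have [a0|/ltW a0] := leP 0 alpha.
    apply: le_trans C0; apply: log_wealth_le0 => //.
    by rewrite sumE mulr_le0_ge0// subr_le0.
  apply: le_trans (le_trans (le_log_wealth _ _ n _ _ mu01 v01 v01' vv' Ba a0) _) supC.
  by apply: ereal_sup_ubound; exists alpha.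
exists m; first by rewrite (ltW mum).
have m01 : (0 <= m <= 1)%R by rewrite m0.
apply: ge_ereal_sup => _ [alpha Ba <-]; apply: le_trans C0.
by have [a0|/ltW a0] := leP 0 alpha;
  [apply: log_wealth_le0|apply: log_wealth_le0_npos] => //; rewrite sumE subrr mul0r.
Qed.

Lemma sup_log_wealth_down v v' n mu (C : \bar R) : (0 < n)%N -> (0 <= mu <= 1)%R ->
  (forall t, 0 <= v t <= 1)%R -> (forall t, 0 <= v' t <= 1)%R ->
  (forall t, v' t <= v t)%R -> 0 <= C -> sup_log_wealth v n mu <= C ->
  exists2 mu', (0 <= mu' <= mu)%R & sup_log_wealth v' n mu' <= C.
Proof.
move=> n0 mu01 v01 v01' vv' C0; rewrite -sup_log_wealth_flip => supC.
have [|t|t|t|m mm] := @sup_log_wealth_up _ (fun t => 1 - v' t)%R _ _ _ n0 _ _ _ _ C0 supC.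
- by lra.
- by have := v01 t; lra.
- by have := v01' t; lra.
- by have := vv' t; lra.
rewrite -{1}(subKr 1%R m) sup_log_wealth_flip => ?.
by exists (1 - m)%R => //; lra.
Qed.

Lemma lneM_ge0 (r s : R) : (0 <= r)%R -> (0 <= s)%R ->
  lne (r * s)%:E = lne r%:E + lne s%:E.
Proof.
rewrite [in X in X -> _]le_eqVlt => /predU1P[<- _|r0].
  by rewrite mul0r !(le0_lneNy (x := 0))// addNye.
rewrite le_eqVlt => /predU1P[<-|s0].
  by rewrite mulr0 !(le0_lneNy (x := 0))// addeNy.
by rewrite EFinM lneM// in_itv/= lte_fin leey ?r0 ?s0.
Qed.

Lemma lne_prod n (z : 'I_n -> R) : (forall t, 0 <= z t)%R ->
  lne (\prod_(t < n) z t)%:E = \sum_(t < n) lne (z t)%:E.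
Proof.
elim: n z => [|n IH] z z0; first by rewrite !big_ord0 lne1.
by rewrite !big_ord_recr lneM_ge0 ?IH//; apply: prodr_ge0.
Qed.

Lemma sup_log_wealth_le_kt v n mu : (0 < n)%N -> (0 < mu < 1)%R ->
  (forall t, 0 <= v t <= 1)%R ->
  sup_log_wealth v n mu <= lne (2 * Num.sqrt n%:R *
    mixture kt (fun t => v t / mu) (fun t => (1 - v t) / (1 - mu)) n)%:E.
Proof.
move=> n0 mu01 v01; have /andP[mu0 mu1] := mu01.
have nu0 : (0 < 1 - mu)%R by lra.
apply: ge_ereal_sup => _ [[r Br|/bets_pinfty mu0'|[Ny_ge _]] <-]; last 2 first.
- by rewrite mu0' ltxx in mu0.
- by rewrite inver gt_eqF in Ny_ge.
have [r_ge r_le] := (bets_fin _ r mu01).1 Br.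
(* The bet [r] puts the fraction [p] of the wealth on the outcome 1 and [1 - p] on
   the outcome 0, at the fair odds [1 / mu] and [1 / (1 - mu)]. *)
pose p := (mu + r * mu * (1 - mu))%R.
(* Since [p = mu (1 + r (1 - mu))] and [1 - p = (1 - mu) (1 - r mu)], the bounds on [r] say exactly
   that [p] and [1 - p] are nonnegative. *)
have p0 : (0 <= p)%R.
  have := ler_wpM2r (ltW nu0) r_ge; rewrite mulNr mulVf ?gt_eqF// => rn.
  by rewrite /p; nra.
have p1 : (0 <= 1 - p)%R.
  have := ler_wpM2r (ltW mu0) r_le; rewrite mulVf ?gt_eqF// => rn.
  by rewrite /p; nra.
have payoffE (t : 'I_n) : 1 + r%:E * (v t - mu)%:E =
    (v t / mu * p + (1 - v t) / (1 - mu) * (1 - p))%:E.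
  rewrite -EFinM -EFinD; congr EFin; rewrite /p; field.
  by rewrite !gt_eqF.
have a0 t : (0 <= v t / mu)%R.
  by case/andP: (v01 t) => v0 _; apply: divr_ge0 => //; exact: ltW.
have b0 t : (0 <= (1 - v t) / (1 - mu))%R.
  by case/andP: (v01 t) => _ v1; apply: divr_ge0; [rewrite subr_ge0|exact: ltW].
rewrite /log_wealth (eq_bigr _ (fun t _ => congr1 (@lne R) (payoffE t))).
rewrite -lne_prod; last first.
  by move=> t; rewrite addr_ge0// mulr_ge0.
have pp : (p + (1 - p) = 1)%R by ring.
have le_kt := kt_wealth_ge _ _ _ _ _ n0 a0 b0 p0 p1 pp.
have prod0 : (0 <= \prod_(t < n) (v t / mu * p + (1 - v t) / (1 - mu) * (1 - p)))%R.
  by rewrite prodr_ge0// => t _; rewrite addr_ge0// mulr_ge0.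
by rewrite lee_lne ?in_itv/= ?lee_fin ?leey ?andbT// (le_trans prod0).
Qed.

End log_wealth.

(** * Values and bounds of the threshold *)

Section threshold.
Local Open Scope ereal_scope.
Context {R : realType}.
Implicit Types (n : nat) (gap delta W : R).

Lemma threshold0 n delta : (0 < n)%N -> threshold n 0 delta = +oo.
Proof.
move=> n0; rewrite /threshold mul0r inve0 gt0_muley// lte_fin.
by rewrite mulr_gt0// sqrtr_gt0 ltr0n.
Qed.

Lemma thresholdE n gap delta : (0 < gap)%R -> (0 < delta)%R ->
  threshold n gap delta = lne (2 * Num.sqrt n%:R / (gap * delta))%:E.
Proof. by move=> g0 d0; rewrite /threshold inver gt_eqF// mulr_gt0. Qed.

Lemma threshold_ge0 n gap delta : (0 < n)%N -> (0 <= gap <= 1)%R ->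
  (0 < delta <= 1)%R -> 0 <= threshold n gap delta.
Proof.
move=> n0 /andP[]; rewrite [in X in X -> _]le_eqVlt => /predU1P[<- _ _|g0 g1].
  by rewrite threshold0.
move=> /andP[d0 d1]; rewrite thresholdE// lne_ge0 lee_fin.
have sqrt1 : (1 <= Num.sqrt n%:R :> R)%R by rewrite -[leLHS]sqrtr1 ler_wsqrtr// ler1n.
rewrite ler_pdivlMr ?mulr_gt0// mul1r; nra.
Qed.

Lemma le_threshold n gap delta W : (0 < gap)%R -> (0 < delta)%R -> (0 <= W)%R ->
  (W <= (gap * delta)^-1)%R ->
  lne (2 * Num.sqrt n%:R * W)%:E <= threshold n gap delta.
Proof.
move=> g0 d0 W0 Wle; rewrite thresholdE//.
have c0 : (0 <= 2 * Num.sqrt n%:R :> R)%R by rewrite mulr_ge0.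
rewrite lee_lne ?in_itv/= ?lee_fin ?leey ?andbT ?mulr_ge0//.
  exact: ler_wpM2l.
by rewrite invr_ge0 mulr_ge0// ltW.
Qed.

End threshold.

(** * The uniform law on [0, 1] *)

Section uniform01.
Local Open Scope ereal_scope.
Context {R : realType}.

(* [measurableTypeR R], the carrier of the uniform measure, is not the canonical
   measurable type on [R], although the sigma-algebras are the same. *)
Definition of_measurableTypeR (y : measurableTypeR R) : R := y.

Lemma measurable_of_measurableTypeR : measurable_fun setT of_measurableTypeR.
Proof. exact: measurable_id. Qed.

HB.instance Definition _ :=
  isMeasurableFun.Build _ _ _ _ _ measurable_of_measurableTypeR.

Definition uniform01 : probability R R :=
  distribution (uniform_prob (@ltr01 R)) of_measurableTypeR.

Lemma uniform01_ge (h : R -> \bar R) (s t c : R) : measurable_fun setT h ->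
  (forall y, 0 <= h y) -> (0 <= s)%R -> (s < t)%R -> (t <= 1)%R -> (0 <= c)%R ->
  (forall y, (s < y < t)%R -> c%:E <= h y) ->
  (c * (t - s))%:E <= \int[uniform01]_y h y.
Proof.
move=> mh h0 s0 st t1 c0 ch; rewrite ge0_integral_distribution//.
rewrite integral_uniform//=.
rewrite subr0 invr1 mul1e.
have sub01 : `]s, t[%classic `<=` `[0%R, 1%R]%classic.
  move=> y /=; rewrite !in_itv/= => /andP[sy yt].
  by rewrite (le_trans s0 (ltW sy)) (le_trans (ltW yt)).
have mh' : measurable_fun setT (fun y : measurableTypeR R => h y) by [].
apply: (@le_trans _ _ (\int[lebesgue_measure]_(y in `]s, t[) h y)); last first.
  by apply: ge0_subset_integral => //; exact: measurable_funTS.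
apply: (@le_trans _ _ (\int[lebesgue_measure]_(y in `]s, t[) c%:E)).
  by rewrite integral_cst//= lebesgue_measure_itv/= lte_fin st -EFinB -EFinM.
apply: ge0_le_integral => //.
exact: measurable_funTS.
Qed.

End uniform01.

(** * Almost sure values of the samples *)

Section null_events.
Local Open Scope ereal_scope.
Context {dO d' : measure_display} {Omega : measurableType dO}
  {S : measurableType d'} {R : realType} {Pr : probability Omega R}
  {P : probability S R} {X : nat -> {RV Pr >-> S}}.

Lemma ae_eq0_sample (HX : iid_with_law P X) j (h : S -> R) :
  measurable_fun setT h -> (forall x, (0 <= h x)%R) ->
  \int[P]_x (h x)%:E = 0 -> {ae Pr, forall w, h (X j w) = 0%R}.
Proof.
move=> mh h0 ih0; have [_ lawX] := HX.
have mhE : measurable_fun setT (EFin \o h) by exact/measurable_EFinP.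
have : ae_eq Pr setT (fun w => (h (X j w))%:E) (cst 0).
  apply/ae_eq_integral_abs => //.
    by apply/measurable_EFinP; exact: measurableT_comp.
  under eq_integral do rewrite abse_EFin ger0_norm//.
  rewrite -[LHS]/(\int[Pr]_w ((EFin \o h) \o X j) w).
  rewrite -(ge0_integral_distribution (X j)) => [|//|x]; last by rewrite lee_fin.
  by rewrite (eq_measure_integral P)// => A mA _; exact: lawX.
by apply: filterS => w /(_ I)[].
Qed.

End null_events.

(** * Confidence bounds uniform in y *)

Section uniform_confidence.
Context {dO d' : measure_display} {Omega : measurableType dO}
  {S : measurableType d'} {R : realType} {Pr : probability Omega R}
  {P : probability S R} {X : nat -> {RV Pr >-> S}}.
Variable f : S -> R -> R.
Hypothesis HX : iid_with_law P X.
Hypothesis f_borel : measurable_fun ([set: S] `*` `[0 : R, 1 : R])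
  (fun p : S * R => f p.1 p.2).
Hypothesis f_range : forall (x : S) (y : R), 0 <= y <= 1 -> 0 <= f x y <= 1.
Hypothesis f_mono : forall (x : S) (y y' : R),
  0 <= y -> y <= y' -> y' <= 1 -> f x y <= f x y'.

(* [f] is controlled only for [y] in [0, 1]. *)
Let clamp (y : R) : R := Num.max 0 (Num.min y 1).

Let clamp01 y : 0 <= clamp y <= 1.
Proof. by rewrite /clamp le_max lexx/= ge_max ler01 ge_min lexx orbT. Qed.

Let clamp_id y : 0 <= y <= 1 -> clamp y = y.
Proof. by move=> /andP[? ?]; rewrite /clamp min_l// max_r. Qed.

Let fc (z : S * R) : R := f z.1 (clamp z.2).

Let fc01 z : 0 <= fc z <= 1. Proof. exact: f_range. Qed.

Let measurable_fc : measurable_fun setT fc.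
Proof.
apply: (@measurable_comp _ _ _ _ _ _ ([set: S] `*` `[0 : R, 1 : R])
  (fun p : S * R => f p.1 p.2) setT (fun z : S * R => (z.1, clamp z.2))) => //.
- by apply: measurableX => //; exact: measurable_itv.
- by move=> _ [z _ <-]; split => //=; rewrite in_itv/=.
- apply: measurable_fun_pair => //.
  apply: measurable_maxr; first exact: measurable_cst.
  by apply: measurable_minr; [exact: measurable_snd|exact: measurable_cst].
Qed.

Let measurable_fcx y : measurable_fun setT (fun x => fc (x, y)).
Proof. exact: measurable_fun_pair1. Qed.

Let Fbar (y : R) : R := fine (\int[P]_x (fc (x, y))%:E)%E.

Let FbarE y : (\int[P]_x (fc (x, y))%:E = (Fbar y)%:E)%E.
Proof.
rewrite /Fbar fineK// ge0_fin_numE; last first.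
  by apply: integral_ge0 => x _; rewrite lee_fin; case/andP: (fc01 (x, y)).
apply: (@le_lt_trans _ _ (\int[P]_x (1%:E : \bar R))%E); last first.
  by rewrite integral_cst// -[X in (_ * X)%E]/(P setT) probability_setT mule1 ltry.
apply: ge0_le_integral => //.
- by move=> x _; rewrite lee_fin; case/andP: (fc01 (x, y)).
- by apply/measurable_EFinP.
- by move=> x _; rewrite lee_fin; case/andP: (fc01 (x, y)).
Qed.

Let integral_1Bfc y : (\int[P]_x (1 - fc (x, y))%:E = (1 - Fbar y)%:E)%E.
Proof.
have : (\int[P]_x (1 - fc (x, y))%:E + \int[P]_x (fc (x, y))%:E = 1)%E.
  rewrite -ge0_integralD//.
  - under eq_integral do rewrite -EFinD subrK.
    by rewrite integral_cst// -[X in (_ * X)%E]/(P setT) probability_setT mule1.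
  - by move=> x _; rewrite lee_fin subr_ge0; case/andP: (fc01 (x, y)).
  - by apply/measurable_EFinP; apply: measurable_funB => //; exact: measurable_cst.
  - by move=> x _; rewrite lee_fin; case/andP: (fc01 (x, y)).
  - by apply/measurable_EFinP.
rewrite FbarE; case: (\int[P]_x _)%E => // r; rewrite -EFinD => -[rF].
by congr EFin; lra.
Qed.

Let Fbar01 y : 0 <= Fbar y <= 1.
Proof.
have := integral_1Bfc y; have := FbarE y; rewrite -!lee_fin => <- E.
apply/andP; split.
  by apply: integral_ge0 => x _; rewrite lee_fin; case/andP: (fc01 (x, y)).
rewrite FbarE lee_fin -subr_ge0 -lee_fin -E.
by apply: integral_ge0 => x _; rewrite lee_fin subr_ge0; case/andP: (fc01 (x, y)).
Qed.

Let le_Fbar (y y' : R) : 0 <= y -> y <= y' -> y' <= 1 -> Fbar y <= Fbar y'.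
Proof.
move=> y0 yy' y1; rewrite -lee_fin -!FbarE; apply: ge0_le_integral => //.
- by move=> x _; rewrite lee_fin; case/andP: (fc01 (x, y)).
- by apply/measurable_EFinP.
- by apply/measurable_EFinP.
- move=> x _; rewrite lee_fin /fc/= !clamp_id ?f_mono//.
    by rewrite (le_trans y0).
  by rewrite y0 (le_trans yy').
Qed.

Let measurable_Fbar : measurable_fun setT Fbar.
Proof.
apply: (measurableT_comp (fine_measurable measurableT)).
apply: (@measurable_fun_fubini_tonelli_G _ _ S R R P (EFin \o fc)).
  exact/measurable_EFinP.
by move=> z; rewrite lee_fin; case/andP: (fc01 z).
Qed.

(** The value 1 at degenerate means keeps the expectation equal to 1 for every [y]. *)
Let up (z : S * R) : R := if 0 < Fbar z.2 < 1 then fc z / Fbar z.2 else 1.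
Let down (z : S * R) : R :=
  if 0 < Fbar z.2 < 1 then (1 - fc z) / (1 - Fbar z.2) else 1.

Let measurable_Fbar2 : measurable_fun setT (fun z : S * R => Fbar z.2).
Proof. exact: measurableT_comp measurable_snd. Qed.

Let measurable_nondegenerate :
  measurable_fun setT (fun z : S * R => 0 < Fbar z.2 < 1).
Proof.
by apply: measurable_and; apply: measurable_fun_ltr => //; exact: measurable_cst.
Qed.

Let measurable_up : measurable_fun setT up.
Proof.
apply: measurable_fun_ifT => //.
apply: measurable_funM => //.
(* Measurability of the inverse comes from that of the power -1, with which it agrees on nonnegative
   reals. *)
rewrite (_ : (fun _ => _) = (@powR R ^~ (-1)) \o (fun z : S * R => Fbar z.2)).
  by apply: measurableT_comp => //; exact: measurable_powR.
by apply/funext => z /=; rewrite powR_inv1//; case/andP: (Fbar01 z.2).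
Qed.

Let measurable_down : measurable_fun setT down.
Proof.
apply: measurable_fun_ifT => //.
apply: measurable_funM; first by apply: measurable_funB => //; exact: measurable_cst.
rewrite (_ : (fun _ => _) = (@powR R ^~ (-1)) \o (fun z : S * R => 1 - Fbar z.2)).
  apply: measurableT_comp; first exact: measurable_powR.
  by apply: measurable_funB => //; exact: measurable_cst.
by apply/funext => z /=; rewrite powR_inv1//; have := Fbar01 z.2; lra.
Qed.

Let up_ge0 z : 0 <= up z.
Proof.
rewrite /up; case: ifP => // /andP[F0 _]; apply: divr_ge0; last exact: ltW.
by case/andP: (fc01 z).
Qed.

Let down_ge0 z : 0 <= down z.
Proof.
rewrite /down; case: ifP => // /andP[_ F1].
by apply: divr_ge0; rewrite subr_ge0 ?(ltW F1)//; case/andP: (fc01 z).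
Qed.

Let integral_up y : (\int[P]_x (up (x, y))%:E = 1)%E.
Proof.
have [Fy|/negbTE Fy] := boolP (0 < Fbar y < 1); last first.
  under eq_integral do rewrite /up/= Fy.
  by rewrite integral_cst// -[X in (_ * X)%E]/(P setT) probability_setT mule1.
under eq_integral do rewrite /up/= Fy EFinM.
have /andP[F0 F1] := Fy.
rewrite ge0_integralZr//.
- by rewrite FbarE -EFinM divff// gt_eqF.
- exact/measurable_EFinP.
- by move=> x _; rewrite lee_fin; case/andP: (fc01 (x, y)).
- by rewrite lee_fin invr_ge0 ltW.
Qed.

Let integral_down y : (\int[P]_x (down (x, y))%:E = 1)%E.
Proof.
have [Fy|/negbTE Fy] := boolP (0 < Fbar y < 1); last first.
  under eq_integral do rewrite /down/= Fy.
  by rewrite integral_cst// -[X in (_ * X)%E]/(P setT) probability_setT mule1.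
under eq_integral do rewrite /down/= Fy EFinM.
have /andP[F0 F1] := Fy.
rewrite ge0_integralZr//.
- by rewrite integral_1Bfc -EFinM divff// gt_eqF// subr_gt0.
- by apply/measurable_EFinP; apply: measurable_funB => //; exact: measurable_cst.
- by move=> x _; rewrite lee_fin subr_ge0; case/andP: (fc01 (x, y)).
- by rewrite lee_fin invr_ge0 subr_ge0 ltW.
Qed.

Let wealthR n (x : nat -> S) (y : R) : R := wealth up down n x y.

Let sup_log_wealth_le_wealth n x y : (0 < n)%N -> 0 <= y <= 1 -> 0 < Fbar y < 1 ->
  (sup_log_wealth (fun t => f (x t) y) n (Fbar y) <=
   lne (2 * Num.sqrt n%:R * wealthR n x y)%:E)%E.
Proof.
move=> n0 y01 Fy; have := @sup_log_wealth_le_kt R (fun t => f (x t) y) n (Fbar y) n0 Fy.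
have -> : wealthR n x y = mixture kt (fun t => f (x t) y / Fbar y)
    (fun t => (1 - f (x t) y) / (1 - Fbar y)) n.
  by apply: eq_mixture => // i _; rewrite /up /down/= Fy /fc/= clamp_id.
by apply => t; exact: f_range.
Qed.

Let wealth_bounded delta w : Prop :=
  forall n, (0 < n)%N ->
  (mean_wealth (Q := uniform01) (X := X) up down n w < (delta^-1)%:E)%E.

(* The odds are undefined where [Fbar] is 0 or 1, and there [up] and [down] carry no
   information.  Since [f] is monotone, it is enough that almost surely the samples
   agree with [Fbar] at the rational degenerate points, enumerated by [unpickle]. *)
Let degenerate_agree w : Prop := forall m j, let q := ratr (odflt 0 (unpickle m)) in
  (Fbar q = 1 -> fc (X j w, q) = 1) /\ (Fbar q = 0 -> fc (X j w, q) = 0).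

Let ae_degenerate_agree : {ae Pr, forall w, degenerate_agree w}.
Proof.
apply: ae_foralln => m; apply: ae_foralln => j /=.
set q : R := ratr _.
have ae1 : {ae Pr, forall w, Fbar q = 1 -> fc (X j w, q) = 1}.
  have [F1|/eqP F1] := eqVneq (Fbar q) 1; last by apply: aeW => w /F1.
  have : {ae Pr, forall w, (1 - fc (X j w, q)) = 0}.
    apply: (ae_eq0_sample HX j (fun x => 1 - fc (x, q))).
    - by apply: measurable_funB => //; exact: measurable_cst.
    - by move=> x; have := fc01 (x, q); lra.
    - by rewrite integral_1Bfc F1 subrr.
  by apply: filterS => w ? _; lra.
have ae0 : {ae Pr, forall w, Fbar q = 0 -> fc (X j w, q) = 0}.
  have [F0|/eqP F0] := eqVneq (Fbar q) 0; last by apply: aeW => w /F0.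
  have : {ae Pr, forall w, fc (X j w, q) = 0}.
    apply: (ae_eq0_sample HX j (fun x => fc (x, q))) => //.
    - by move=> x; have := fc01 (x, q); lra.
    - by rewrite FbarE F0.
  by apply: filterS => w ? _.
by apply: filterS2 ae1 ae0 => w.
Qed.

(** Otherwise the wealth exceeds [1 / ((t - s) delta)] on all of []s, t[], and its mean reaches
    [1 / delta]. *)
Let exists_small_wealth (delta : R) w n (s t : R) : 0 < delta ->
  wealth_bounded delta w -> (0 < n)%N -> 0 <= s -> s < t -> t <= 1 ->
  exists2 y, s < y < t & wealthR n (X ^~ w) y <= ((t - s) * delta)^-1.
Proof.
move=> d0 Mw n0 s0 st t1; apply: contrapT => no_y.
have c0 : 0 <= ((t - s) * delta)^-1 by rewrite invr_ge0 mulr_ge0// ?subr_ge0 ltW.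
have := Mw n n0; rewrite ltNge => /negP; apply.
have -> : delta^-1 = ((t - s) * delta)^-1 * (t - s).
  by field; rewrite !gt_eqF ?subr_gt0.
apply: uniform01_ge => //.
- apply/measurable_EFinP.
  apply: (measurable_mixture kt (fun i y => up (X i w, y))
    (fun i y => down (X i w, y))) => i _; exact: measurable_fun_pair2.
- by move=> y; rewrite lee_fin; exact: wealth_ge0.
- move=> y sty; rewrite lee_fin leNgt; apply/negP => lt_c.
  by apply: no_y; exists y => //; exact: ltW.
Qed.

Let sup_log_wealth_le_threshold delta w n (s t y : R) : 0 < delta ->
  (0 < n)%N -> s < t -> 0 <= y <= 1 -> 0 < Fbar y < 1 ->
  wealthR n (X ^~ w) y <= ((t - s) * delta)^-1 ->
  (sup_log_wealth (fun j => f (X j w) y) n (Fbar y) <= threshold n (t - s) delta)%E.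
Proof.
move=> d0 n0 st y01 Fy Wy.
apply: le_trans (sup_log_wealth_le_wealth _ (X ^~ w) _ n0 y01 Fy) _.
by apply: le_threshold => //; [rewrite subr_gt0|exact: wealth_ge0].
Qed.

Let degenerate_between w (y z : R) : degenerate_agree w -> y < z -> exists2 q, y < q < z &
  forall j, (Fbar q = 1 -> fc (X j w, q) = 1) /\ (Fbar q = 0 -> fc (X j w, q) = 0).
Proof.
move=> Dw yz; have [r] := rat_in_itvoo yz; rewrite in_itv/= => yrz.
by exists (ratr r) => // j; have := Dw (pickle r) j; rewrite pickleK.
Qed.

(** The sample [v] is usually the one at a point [y] between [s] and [t]; leaving it existential
    lets constant samples serve in the degenerate cases. Then [sup_log_wealth_up] carries the bound
    from [v] to the sample at [t]. *)
Let upper_witness (delta : R) w n (s t : R) : 0 < delta <= 1 ->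
  wealth_bounded delta w -> degenerate_agree w -> (0 < n)%N ->
  0 <= s -> s <= t -> t <= 1 ->
  exists v mu, [/\ Fbar s <= mu <= 1, forall j, 0 <= v j <= 1,
    forall j, v j <= f (X j w) t &
    (sup_log_wealth v n mu <= threshold n (t - s) delta)%E].
Proof.
move=> /andP[d0 d1] Mw Dw n0 s0 st t1; have Fs01 := Fbar01 s.
have ft01 j : 0 <= f (X j w) t <= 1 by apply: f_range; lra.
have C0 : (0 <= threshold n (t - s) delta)%E by apply: threshold_ge0 => //; lra.
have sup_cst (mu : R) : (sup_log_wealth (fun=> mu) n mu <= threshold n (t - s) delta)%E.
  exact: le_trans (sup_log_wealth_cst _ _) C0.
move: (st); rewrite le_eqVlt => /predU1P[E|{}st].
  (* With an infinite threshold the extreme pair works. *)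
  rewrite E subrr threshold0//; exists (fun=> 0), 1.
  have := Fbar01 t => Ft01; split=> [|j|j|]; [lra|lra| |exact: leey].
  by case/andP: (ft01 j).
have [y /andP[sy yt] Wy] := exists_small_wealth _ _ _ _ _ d0 Mw n0 s0 st t1.
have Fsy : Fbar s <= Fbar y by apply: le_Fbar; lra.
have Fy01 := Fbar01 y.
have [Fy0|Fy0] := eqVneq (Fbar y) 0.
  exists (fun=> 0), 0; split=> [|j|j|] //; [lra|lra|].
  by case/andP: (ft01 j).
have [Fy1|Fy1] := eqVneq (Fbar y) 1.
  (* The mean is also 1 at a rational [q] in []y, t[], where all samples equal 1; by monotonicity
     they are at least 1 at [t]. *)
  have [q /andP[yq qt] Dq] := degenerate_between _ _ _ Dw yt.
  have Fq1 : Fbar q = 1.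
    have := Fbar01 q; have : Fbar y <= Fbar q by apply: le_Fbar; lra.
    by lra.
  exists (fun=> 1), 1; split=> [|j|j|] //; [lra|lra|].
  have [/(_ Fq1) <- _] := Dq j; rewrite /fc/= clamp_id; last by lra.
  by apply: f_mono; lra.
exists (fun j => f (X j w) y), (Fbar y); split => [|j|j|].
- by lra.
- by apply: f_range; lra.
- by apply: f_mono; lra.
- apply: sup_log_wealth_le_threshold => //; first by lra.
  by rewrite lt_neqAle eq_sym Fy0 lt_neqAle Fy1; lra.
Qed.

(** Mirror image of [upper_witness]: the means 0 and 1 exchange their roles, and the rational point
    is taken in []s, y[]. *)
Let lower_witness (delta : R) w n (s t : R) : 0 < delta <= 1 ->
  wealth_bounded delta w -> degenerate_agree w -> (0 < n)%N ->
  0 <= s -> s <= t -> t <= 1 ->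
  exists v mu, [/\ 0 <= mu <= Fbar t, forall j, 0 <= v j <= 1,
    forall j, f (X j w) s <= v j &
    (sup_log_wealth v n mu <= threshold n (t - s) delta)%E].
Proof.
move=> /andP[d0 d1] Mw Dw n0 s0 st t1; have Ft01 := Fbar01 t.
have fs01 j : 0 <= f (X j w) s <= 1 by apply: f_range; lra.
have C0 : (0 <= threshold n (t - s) delta)%E by apply: threshold_ge0 => //; lra.
have sup_cst (mu : R) : (sup_log_wealth (fun=> mu) n mu <= threshold n (t - s) delta)%E.
  exact: le_trans (sup_log_wealth_cst _ _) C0.
move: (st); rewrite le_eqVlt => /predU1P[E|{}st].
  rewrite E subrr threshold0//; exists (fun=> 1), 0.
  split=> [|j|j|]; [lra|lra| |exact: leey].
  by rewrite -E; case/andP: (fs01 j).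
have [y /andP[sy yt] Wy] := exists_small_wealth _ _ _ _ _ d0 Mw n0 s0 st t1.
have Fyt : Fbar y <= Fbar t by apply: le_Fbar; lra.
have Fy01 := Fbar01 y.
have [Fy1|Fy1] := eqVneq (Fbar y) 1.
  exists (fun=> 1), 1; split=> [|j|j|] //; [lra|lra|].
  by case/andP: (fs01 j).
have [Fy0|Fy0] := eqVneq (Fbar y) 0.
  have [q /andP[sq qy] Dq] := degenerate_between _ _ _ Dw sy.
  have Fq0 : Fbar q = 0.
    have := Fbar01 q; have : Fbar q <= Fbar y by apply: le_Fbar; lra.
    by lra.
  exists (fun=> 0), 0; split=> [|j|j|] //; [lra|lra|].
  have [_ /(_ Fq0) <-] := Dq j; rewrite /fc/= clamp_id; last by lra.
  by apply: f_mono; lra.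
exists (fun j => f (X j w) y), (Fbar y); split => [|j|j|].
- by lra.
- by apply: f_range; lra.
- by apply: f_mono; lra.
- apply: sup_log_wealth_le_threshold => //; first by lra.
  by rewrite lt_neqAle eq_sym Fy0 lt_neqAle Fy1; lra.
Qed.

Lemma uniform_confidence_band (delta : R) : 0 < delta -> delta <= 1 ->
  let F (y : R) : \bar R := ('E_P[fun x => f x y])%E in
  exists2 E : set Omega, measurable E /\ ((1 - delta)%:E <= Pr E)%E &
    forall omega, E omega ->
    let x t := X t omega in
    forall T : nat, (1 <= T)%N ->
    forall y0 : R, 0 <= y0 <= 1 ->
      F y0 \in `[ ereal_sup [set psi_inv_minus f x T ym
                                   (threshold T (y0 - ym) delta)
                            | ym in `[0, y0]],
                  ereal_inf [set psi_inv_plus f x T yp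
                                   (threshold T (yp - y0) delta)
                            | yp in `[y0, 1]] ].
Proof.
move=> d0 d1 F.
(* A measurable null set that contains all outcomes where the agreement fails; removing it keeps the
   event measurable and its probability unchanged. *)
have [N [mN PN0 subN]] := ae_degenerate_agree.
pose B := \bigcap_n below (mean_wealth (Q := uniform01) (X := X) up down) delta^-1 n.
have mB : measurable B.
  apply: bigcap_measurableType => n _; apply: measurable_below => j _.
  by apply: (measurable_mean_wealth _ _ measurable_up measurable_down up_ge0 down_ge0 X).
have PB : ((1 - delta)%:E <= Pr B)%E.
  rewrite -[in X in (X <= _)%E](invrK delta).
  by apply: (mean_wealth_ville up down) => //; rewrite invr_gt0.
exists (B `\` N).
  split; first exact: measurableD.
  rewrite measureD//; last by rewrite ltey_eq fin_num_measure.
  have BN0 : Pr (B `&` N) = 0%E.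
    apply/eqP; rewrite -measure_le0 -PN0; apply: le_measure; rewrite ?inE//.
    exact: measurableI.
  by rewrite [X in (_ - X)%E]BN0 sube0.
move=> w [Bw Nw] x T T1 y0 y01.
have d01 : 0 < delta <= 1 by rewrite d0.
have Mw : wealth_bounded delta w.
  by move=> n n0; apply: (Bw n) => //; rewrite n0 leqnn.
have Dw : degenerate_agree w by apply: contrapT => nD; apply: Nw; exact: subN.
have /andP[y00 y01'] := y01.
have -> : F y0 = (Fbar y0)%:E.
  by rewrite /F unlock -FbarE; apply: eq_integral => z _; rewrite /fc/= clamp_id.
have v01 y : 0 <= y <= 1 -> forall t, 0 <= f (x t) y <= 1 by move=> ? t; exact: f_range.
have Fy01 := Fbar01 y0.
rewrite in_itv/=; apply/andP; split.
  apply: ge_ereal_sup => _ [ym /= + <-]; rewrite in_itv/= => /andP[ym0 ymy0].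
  (* The witness comes from [[ym, y0]]; moving its sample down to the one at [ym] only lowers the
     mean, which yields a point of the sublevel set at most [F y0]. *)
  have [v [mu [mu01 vv v_ge supv]]] := lower_witness _ _ _ _ _ d01 Mw Dw T1 ym0 ymy0 y01'.
  have C0 : (0 <= threshold T (y0 - ym) delta)%E.
    by apply: threshold_ge0 => //; lra.
  have [||mu' mu'01 sup'] :=
    @sup_log_wealth_down _ v (fun t => f (x t) ym) T mu _ T1 _ vv _ v_ge C0 supv.
  - by lra.
  - by apply: v01; lra.
  apply: (@le_trans _ _ mu'%:E); last by rewrite lee_fin; lra.
  by apply: ereal_inf_lbound; exists mu' => //; split => //; lra.
apply: le_ereal_inf_tmp => _ [yp /= + <-]; rewrite in_itv/= => /andP[y0yp yp1].
have [v [mu [mu01 vv v_le supv]]] := upper_witness _ _ _ _ _ d01 Mw Dw T1 y00 y0yp yp1.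
have C0 : (0 <= threshold T (yp - y0) delta)%E.
  by apply: threshold_ge0 => //; lra.
have [||mu' mu'01 sup'] :=
  @sup_log_wealth_up _ v (fun t => f (x t) yp) T mu _ T1 _ vv _ v_le C0 supv.
- by lra.
- by apply: v01; lra.
apply: (@le_trans _ _ mu'%:E); first by rewrite lee_fin; lra.
by apply: ereal_sup_ubound; exists mu' => //; split => //; lra.
Qed.

End uniform_confidence.

Theorem proposition1 (R : realType) (d : nat)
    (calX : set 'rV[R]_d) (calX0 : calX !=set0)
    (P : probability (borel_type calX0) R)
    (dO : measure_display) (Omega : measurableType dO)
    (Pr : probability Omega R)
    (X : nat -> {RV Pr >-> borel_type calX0})
    (HX : iid_with_law P X)
    (f : borel_type calX0 -> R -> R)
    (f_borel : measurable_fun ([set: borel_type calX0] `*` `[0 : R, 1 : R])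
                 (fun p : borel_type calX0 * R => f p.1 p.2))
    (f_range : forall x y, 0 <= y <= 1 -> 0 <= f x y <= 1)
    (f_mono : forall x y y', 0 <= y -> y <= y' -> y' <= 1 -> f x y <= f x y')
    (delta : R) (delta_gt0 : 0 < delta) (delta_le1 : delta <= 1) :
  let F (y : R) : \bar R := ('E_P[fun x => f x y])%E in
  exists2 E : set Omega, measurable E /\ ((1 - delta)%:E <= Pr E)%E &
    forall omega, E omega ->
    let x t := X t omega in
    forall T : nat, (1 <= T)%N ->
    forall y0 : R, 0 <= y0 <= 1 ->
      F y0 \in `[ ereal_sup [set psi_inv_minus f x T ym
                                   (threshold T (y0 - ym) delta)
                            | ym in `[0, y0]],
                  ereal_inf [set psi_inv_plus f x T yp
                                   (threshold T (yp - y0) delta)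
                            | yp in `[y0, 1]] ].
Proof. exact: (uniform_confidence_band f HX f_borel f_range f_mono). Qed.
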